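(* Let $\Omega\subseteq\mathbb{R}^n$ be a bounded open set with Lipschitz boundary. There exists a constant $\Theta>0$, depending only on $n$, $s$, and $g$, such that if $u\in\mathcal{W}^s(\Omega)$ is a minimizer of $\mathcal{F}$ in $\Omega$, bounded in $\Omega_{\Theta\,\mathrm{diam}(\Omega)}\setminus\Omega$, then $u$ is also bounded in $\Omega$ and satisfies $$\|u\|_{L^\infty(\Omega)}\le\mathrm{diam}(\Omega)+\|u\|_{L^\infty(\Omega_{\Theta\,\mathrm{diam}(\Omega)}\setminus\Omega)}.$$
   Context: $n\ge1$ is an integer, $s\in(0,1)$, and $g:\mathbb{R}\to(0,1]$ is an even continuous function with $\int_{\mathbb{R}}g(t)|t|\,dt<\infty$. Set $G(t):=\int_0^t g(\tau)\,d\tau$ and $\mathcal{G}(t):=\int_0^t G(\tau)\,d\tau$. For an open set $\Omega\subseteq\mathbb{R}^n$, $Q(\Omega):=\mathbb{R}^{2n}\setminus(\mathbb{R}^n\setminus\Omega)^2$, and $\mathcal{W}^s(\Omega):=\{u:\mathbb{R}^n\to\mathbb{R}\text{ measurable}: u|_\Omega\in W^{s,1}(\Omega)\}$, where $W^{s,1}(\Omega)$ is the fractional Sobolev space of $u\in L^1(\Omega)$ with $\int_\Omega\int_\Omega\frac{|u(x)-u(y)|}{|x-y|^{n+s}}\,dx\,dy<\infty$. $u$ is a minimizer of $\mathcal{F}$ in $\Omega$ (bounded, Lipschitz) if $u\in\mathcal{W}^s(\Omega)$ and $$\iint_{Q(\Omega)}\left\{\mathcal{G}\left(\frac{u(x)-u(y)}{|x-y|}\right)-\mathcal{G}\left(\frac{v(x)-v(y)}{|x-y|}\right)\right\}\frac{dx\,dy}{|x-y|^{n-1+s}}\le0$$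 for every $v\in\mathcal{W}^s(\Omega)$ with $v=u$ a.e. in $\mathbb{R}^n\setminus\Omega$ (the integral converges absolutely for all such $u,v$). For $\varrho>0$, $\Omega_\varrho:=\{x\in\mathbb{R}^n:\mathrm{dist}(x,\Omega)<\varrho\}$. Boundedness is understood in the $L^\infty$ (essential) sense. *)

(* Defs.v *)
From HB Require Import structures.
From mathcomp Require Import all_boot all_order all_algebra.
From mathcomp Require Import all_classical all_reals all_analysis.

Set Implicit Arguments.
Unset Strict Implicit.
Unset Printing Implicit Defensive.

Import Order.TTheory GRing.Theory Num.Theory.
Import numFieldNormedType.Exports.

Local Open Scope classical_set_scope.
Local Open Scope ring_scope.

Definition measure_rV_display : measure_display -> measure_display.
Proof. exact. Qed.

(* 'rV[R]_n carries the product of the Borel sigma-algebras of R (as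
   n.-tuple does in the library), that is, the Borel sigma-algebra of R^n. *)
Section measurable_rV.
Context {R : realType} (n : nat).

Let coors : 'I_n -> 'rV[R]_n -> R := fun i x => x ord0 i.

Let rV_set0 : g_sigma_preimage coors set0.
Proof. exact: sigma_algebra0. Qed.

Let rV_setC A : g_sigma_preimage coors A -> g_sigma_preimage coors (~` A).
Proof. exact: sigma_algebraC. Qed.

Let rV_bigcup (F : _^nat) : (forall i, g_sigma_preimage coors (F i)) ->
  g_sigma_preimage coors (\bigcup_i (F i)).
Proof. exact: sigma_algebra_bigcup. Qed.

HB.instance Definition _ :=
  @isMeasurable.Build (measure_rV_display default_measure_display)
    'rV[R]_n (g_sigma_preimage coors) rV_set0 rV_setC rV_bigcup.

End measurable_rV.

Section borel_lebesgue.
Context {R : realType}.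

Lemma measurable_rV_coord n (i : 'I_n) :
  measurable_fun [set: 'rV[R]_n] (fun x : 'rV[R]_n => x ord0 i).
Proof.
move=> _ Y mY; rewrite setTI; apply: sub_sigma_algebra => /=.
rewrite -bigcup_seq/=; exists i => /=; first by rewrite mem_index_enum.
by exists Y => //; rewrite setTI.
Qed.

Lemma measurable_fun_rVP d (T : measurableType d) n (f : T -> 'rV[R]_n) :
  (forall i, measurable_fun [set: T] (fun t => f t ord0 i)) ->
  measurable_fun [set: T] f.
Proof.
move=> mf.
have : g_sigma_preimage (fun (i : 'I_n) t => f t ord0 i) `<=` measurable.
  apply: smallest_sub; first exact: sigma_algebra_measurable.
  case: n => [|n] in f mf *; first by rewrite big_ord0.
  rewrite -bigcup_mkord_ord; apply: bigcup_sub => i Ii.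
  by move=> A [B mB <-]; exact: mf.
rewrite (g_sigma_preimage_comp (fun (i : 'I_n) (x : 'rV[R]_n) => x ord0 i) f).
by move=> H _ A mA; apply: H; exists A.
Qed.

Definition rV_cons n (p : measurableTypeR R * 'rV[R]_n) : 'rV[R]_n.+1 :=
  \row_i if unlift ord0 i is Some j then p.2 ord0 j else p.1.

Definition rV_uncons n (x : 'rV[R]_n.+1) : measurableTypeR R * 'rV[R]_n :=
  (x ord0 ord0, \row_j x ord0 (lift ord0 j)).

Lemma rV_consK n : cancel (@rV_cons n) (@rV_uncons n).
Proof.
move=> [a v]; rewrite /rV_uncons /rV_cons mxE unlift_none /=; congr pair.
by apply/rowP => j; rewrite !mxE liftK.
Qed.

Lemma rV_unconsK n : cancel (@rV_uncons n) (@rV_cons n).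
Proof.
move=> x; apply/rowP => i; rewrite mxE.
by case: unliftP => [j ->|->] //=; rewrite mxE.
Qed.

Lemma measurable_rV_cons n : measurable_fun setT (@rV_cons n).
Proof.
apply: measurable_fun_rVP => i; rewrite /rV_cons.
under eq_fun do rewrite mxE.
case: unliftP => [j _|_]; last exact: measurable_fst.
by apply: (measurableT_comp (@measurable_rV_coord n j)); exact: measurable_snd.
Qed.

Lemma measurable_rV_uncons n : measurable_fun setT (@rV_uncons n).
Proof.
apply/measurable_fun_pairP; split; first exact: measurable_rV_coord.
apply: measurable_fun_rVP => i; rewrite /rV_uncons /comp/=.
by under eq_fun do rewrite mxE; exact: measurable_rV_coord.
Qed.

Section borel_lebesgue_step.
Variables (n : nat) (mu : {sigma_finite_measure set 'rV[R]_n -> \bar R}).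

Definition borel_lebesgue_step : set 'rV[R]_n.+1 -> \bar R :=
  pushforward (lebesgue_measure \x mu)%E (@rV_cons n).

Let step0 : borel_lebesgue_step set0 = 0%E.
Proof. by rewrite /borel_lebesgue_step /pushforward preimage_set0 measure0. Qed.

Let step_ge0 A : (0 <= borel_lebesgue_step A)%E.
Proof. exact: (measure_ge0 (lebesgue_measure \x mu)%E). Qed.

Let step_sigma_additive : semi_sigma_additive borel_lebesgue_step.
Proof.
move=> F mF tF mUF; rewrite /borel_lebesgue_step /pushforward preimage_bigcup.
apply: (@measure_semi_sigma_additive _ _ _ (lebesgue_measure \x mu)%E).
- by move=> i; rewrite -[X in measurable X]setTI; exact: measurable_rV_cons.
- apply/trivIsetP => /= i j _ _ ij; rewrite -preimage_setI.
  by move/trivIsetP : tF => /(_ _ _ _ _ ij) ->//; rewrite preimage_set0.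
- by rewrite -preimage_bigcup -[X in measurable X]setTI;
    exact: measurable_rV_cons.
Qed.

HB.instance Definition _ := isMeasure.Build _ _ _ borel_lebesgue_step
  step0 step_ge0 step_sigma_additive.

Let step_sigma_finite : sigma_finite setT borel_lebesgue_step.
Proof.
have /sigma_finiteP[F [FT ndF Foo]] := sigma_finiteT (@lebesgue_measure R).
have /sigma_finiteP[G [GT ndG Goo]] := sigma_finiteT mu.
exists (fun i => @rV_uncons n @^-1` (F i `*` G i)).
  rewrite -preimage_bigcup -[LHS](preimage_setT (@rV_uncons n)) -setXTT FT GT.
  congr (_ @^-1` _); apply/seteqP; split=> -[x y]; last first.
    by move=> [k _ [/= Fx Gy]]; split; exists k.
  move=> [/= [k _ Fx] [l _ Gy]]; exists (maxn k l) => //; split => /=.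
    by move: x Fx; exact/subsetPset/ndF/leq_maxl.
  by move: y Gy; exact/subsetPset/ndG/leq_maxr.
move=> i; have [mF Fi] := Foo i; have [mG Gi] := Goo i.
have mFG : measurable (F i `*` G i) by exact: measurableX.
split; first by rewrite -[X in measurable X]setTI; exact: measurable_rV_uncons.
rewrite /borel_lebesgue_step /pushforward -comp_preimage.
rewrite (_ : _ \o _ = id); last by apply/funext => x /=; rewrite rV_consK.
by rewrite preimage_id product_measure1E// lte_mul_pinfty// ge0_fin_numE.
Qed.

HB.instance Definition _ := Measure_isSigmaFinite.Build _ _ _
  borel_lebesgue_step step_sigma_finite.

End borel_lebesgue_step.

(* The Lebesgue measure on the Borel sets of R^n, as an iterated product. *)
Fixpoint borel_lebesgue (n : nat) :
    {sigma_finite_measure set 'rV[R]_n -> \bar R} :=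
  match n with
  | 0 => @dirac _ 'rV[R]_0 0 R
  | m.+1 => borel_lebesgue_step (borel_lebesgue m)
  end.

Lemma borel_lebesgue_box n (B : 'I_n -> set R) :
  (forall i, measurable (B i)) ->
  borel_lebesgue n [set x | forall i, B i (x ord0 i)] =
  (\prod_(i < n) lebesgue_measure (B i))%E.
Proof.
elim: n B => [|n IH] B mB.
  rewrite big_ord0 /= diracE mem_set//= => -[]//.
rewrite big_ord_recl -IH//= /borel_lebesgue_step /pushforward.
rewrite -product_measure1E//.
- congr (product_measure1 _ _ _); apply/seteqP; split => -[a v] /=.
    move=> H; split; first by have := H ord0; rewrite mxE unlift_none.
    by move=> i; have := H (lift ord0 i); rewrite mxE liftK.
  by move=> [Ba Bv] i; rewrite mxE; case: unliftP => [j ->|->].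
- exact: mB.
- set C := (X in measurable X); have -> : C = \bigcap_(i in [set: 'I_n])
      ((fun x : 'rV[R]_n => x ord0 i) @^-1` B (lift ord0 i)).
    by apply/seteqP; split => x /= H i; [move=> _; exact: H|exact: H].
  apply: fin_bigcap_measurable => // i _; rewrite -[X in measurable X]setTI.
  exact: measurable_rV_coord.
Qed.

End borel_lebesgue.

(* The complete Lebesgue measure of R^n: [lebesgue_rV R n] is R^n with the
   Lebesgue sigma-algebra, obtained like [completed_lebesgue_measure] on R. *)
Definition lebesgue_rV (R : realType) (n : nat) :=
  caratheodory_type (borel_lebesgue (R := R) n)^*%mu.

Section lebesgue_rV_measure.
Context {R : realType} {n : nat}.

HB.instance Definition _ := Measurable.on (lebesgue_rV R n).

Definition lebesgue_rV_measure : set (lebesgue_rV R n) -> \bar R :=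
  @completed_measure_extension _ _ _ (borel_lebesgue n).

HB.instance Definition _ := Measure.on lebesgue_rV_measure.

Let lebesgue_rV_sigma_finite : sigma_finite setT lebesgue_rV_measure.
Proof.
exact/completed_measure_extension_sigma_finite/sigma_finiteT.
Qed.

HB.instance Definition _ := @Measure_isSigmaFinite.Build _ _ _
  lebesgue_rV_measure lebesgue_rV_sigma_finite.

End lebesgue_rV_measure.

Section euclidean.
Context {R : realType} {n : nat}.
Implicit Types (x y : 'rV[R]_n) (A : set 'rV[R]_n).

(* The library norm of 'rV[R]_n is the sup norm. *)
Definition enorm x : R := Num.sqrt (\sum_(i < n) x ord0 i ^+ 2).

(* diam set0 = 0 *)
Definition diam A : R := sup [set enorm (p.1 - p.2) | p in A `*` A].

(* dist x set0 = +oo *)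
Definition dist x A : \bar R := ereal_inf [set (enorm (x - y))%:E | y in A].

Definition neighborhood A (r : R) : set 'rV[R]_n :=
  [set x | (dist x A < r%:E)%E].

Definition Linfty_norm A (u : 'rV[R]_n -> R) : \bar R :=
  'N[@lebesgue_rV_measure R n]_+oo[(EFin \o u) \_ A].

End euclidean.

(* Near each boundary point, after an orthogonal change of coordinates M, A is
   the strict epigraph, in the direction of the k-th new coordinate, of a
   Lipschitz function of the n.-1 other ones (col' k drops the k-th one). *)
Definition lipschitz_boundary (R : realType) (n : nat) (A : set 'rV[R]_n) :=
  forall p : 'rV[R]_n, (closure A `\` interior A) p ->
  exists (r L : R) (M : 'M[R]_n) (k : 'I_n) (phi : 'rV[R]_n.-1 -> R),
    [/\ 0 < r, M *m M^T = 1%:M,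
      (forall a b, `|phi a - phi b| <= L * enorm (a - b)) &
      (forall x : 'rV[R]_n, enorm (x - p) < r ->
        (A x <-> phi (col' k (x *m M)) < (x *m M) ord0 k))].

Definition oriented_integral (R : realType) (a b : R) (f : R -> R) : R :=
  if a <= b then \int[lebesgue_measure]_(t in `[a, b]) f t
  else - \int[lebesgue_measure]_(t in `[b, a]) f t.

Section functional.
Context {R : realType}.

Definition primitive (f : R -> R) (t : R) : R := oriented_integral 0 t f.

Context {n : nat}.
Local Notation mu := (@lebesgue_rV_measure R n).
Implicit Types (Om : set 'rV[R]_n) (u v : 'rV[R]_n -> R) (s : R).

Definition Ws1 s Om u : Prop :=
  mu.-integrable Om (EFin \o u) /\
  (\int[mu]_(x in Om) \int[mu]_(y in Om)
     (`|u x - u y| / enorm (x - y) `^ (n%:R + s))%:E < +oo)%E.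

(* The domain [lebesgue_rV R n] makes u Lebesgue measurable. *)
Definition calW s Om u : Prop :=
  measurable_fun [set: lebesgue_rV R n] (u : lebesgue_rV R n -> R) /\
  Ws1 s Om u.

Definition Qset Om : set ('rV[R]_n * 'rV[R]_n) := ~` (~` Om `*` ~` Om).

Definition minimizer s (g : R -> R) Om u : Prop :=
  calW s Om u /\
  forall v, calW s Om v ->
    {ae mu, forall x, (~` Om) x -> v x = u x} ->
    (\int[mu \x mu]_(z in Qset Om)
      ((primitive (primitive g) ((u z.1 - u z.2) / enorm (z.1 - z.2)) -
        primitive (primitive g) ((v z.1 - v z.2) / enorm (z.1 - z.2))) /
       enorm (z.1 - z.2) `^ (n%:R - 1 + s))%:E <= 0)%E.

End functional.

(* Main.v *)
Require Import Defs.
From HB Require Import structures.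
From mathcomp Require Import all_boot all_order all_algebra.
From mathcomp Require Import all_classical all_reals all_analysis.
From mathcomp Require Import measurable_realfun ess_sup_inf ring lra.

Set Implicit Arguments.
Unset Strict Implicit.
Unset Printing Implicit Defensive.

Import Order.TTheory GRing.Theory Num.Theory.
Import numFieldNormedType.Exports.

Local Open Scope classical_set_scope.
Local Open Scope ring_scope.

(* Compare u with its truncation v = min(u, M) on Omega, where d = diam Omega,
   M = d + N0 and N0 bounds u on the collar of width Theta d; let w = u - v.
   The integrand is nonnegative for pairs in Omega, since truncation is a
   contraction, and for x in Omega and y in the collar, since there
   u(x) - u(y) >= v(x) - v(y) >= d wherever w(x) > 0. By convexity it is even at
   least c w(x) d^(-n-s) on the annulus d < |x-y| < 2d, whose volume is of order
   d^n: the gain is at least alpha d^(-s) times the integral of w. It can be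
   negative only for |x-y| >= Theta d, where the primitive of g being bounded
   gives at least -K (w(x) + w(y)) |x-y|^(-n-s): the loss is at most
   beta (Theta d)^(-s) times the integral of w. For Theta large, depending only
   on alpha and beta, minimality forces w = 0. The same applies to -u. *)

(** * Primitives of continuous functions on the line *)

Section primitive_calculus.
Context {R : realType}.
Implicit Types (f : R -> R) (a b c t : R).
Local Notation mu := (@lebesgue_measure R).

Lemma continuous_integrable_itv f a b : continuous f ->
  mu.-integrable `[a, b] (EFin \o f).
Proof.
move=> cf; apply: continuous_compact_integrable; first exact: segment_compact.
exact: continuous_subspaceT.
Qed.

Lemma primitiveN f t : continuous f ->
  primitive f (- t) = - primitive (f \o -%R) t.
Proof.
move=> cf; rewrite /primitive /oriented_integral oppr_ge0.
have E a b : a <= b ->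
    \int[mu]_(x in `[a, b]) (f \o -%R) x = \int[mu]_(x in `[- b, - a]) f x.
  move=> ab; rewrite /Rintegral; congr fine.
  rewrite -[in RHS](opprK a) -[in RHS](opprK b).
  rewrite integration_by_substitution_oppr ?lerN2 ?opprK//.
  exact: continuous_subspaceT.
case: (ltgtP t 0) => t0; first by rewrite E ?ltW// oppr0 opprK.
- by rewrite E ?ltW// oppr0.
- by rewrite t0 oppr0 set_itv1 !Rintegral_set1 oppr0.
Qed.

Lemma primitive_opp f t : continuous f ->
  primitive (\- f) t = - primitive f t.
Proof.
move=> cf; rewrite /primitive /oriented_integral.
have E a b : \int[mu]_(x in `[a, b]) (\- f) x = - \int[mu]_(x in `[a, b]) f x.
  rewrite -mulN1r -RintegralZl//; last exact: continuous_integrable_itv.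
  by apply: eq_Rintegral => x _ /=; rewrite mulN1r.
by case: ifP => _; rewrite E.
Qed.

Lemma primitive_even_odd f t : continuous f -> (forall x, f (- x) = f x) ->
  primitive f (- t) = - primitive f t.
Proof.
move=> cf ef; rewrite primitiveN// (_ : f \o -%R = f)//.
by apply/funext => x /=.
Qed.

Lemma primitive_odd_even f t : continuous f -> (forall x, f (- x) = - f x) ->
  primitive f (- t) = primitive f t.
Proof.
move=> cf ef; rewrite primitiveN// (_ : f \o -%R = \- f).
  by rewrite primitive_opp// opprK.
by apply/funext => x /=.
Qed.

Lemma primitive0 f : primitive f 0 = 0.
Proof.
by rewrite /primitive /oriented_integral lexx set_itv1 Rintegral_set1.
Qed.

(** Only the nonnegative half-line is treated, where a single branch of [oriented_integral] occurs;
    parity reduces all later uses to it. *)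
Lemma primitiveB f a b : continuous f -> 0 <= a -> a <= b ->
  primitive f b - primitive f a = \int[mu]_(x in `[a, b]) f x.
Proof.
move=> cf a0 ab; rewrite /primitive /oriented_integral a0 (le_trans a0 ab).
have i0b := @continuous_integrable_itv f 0 b cf.
rewrite Rintegral_itvB//.
rewrite Rintegral_itv_obnd_cbnd//; apply: integrableS i0b => //.
by apply: subset_itv; rewrite ?bnd_simp.
Qed.

Lemma Rintegral_itv_ge f a b c : continuous f -> a <= b ->
  (forall x, a <= x <= b -> c <= f x) ->
  c * (b - a) <= \int[mu]_(x in `[a, b]) f x.
Proof.
move=> cf ab fc.
have -> : c * (b - a) = \int[mu]_(x in `[a, b]) (cst c) x.
  rewrite (Rintegral_cst mu)//=.
  rewrite lebesgue_measure_itv/= lte_fin.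
  by case: ltgtP ab => // -> _; rewrite subrr.
apply: le_Rintegral => //.
- by apply: continuous_integrable_itv => x; exact: cvg_cst.
- exact: continuous_integrable_itv.
Qed.

Lemma Rintegral_itv_le f a b c : continuous f -> a <= b ->
  (forall x, a <= x <= b -> f x <= c) ->
  \int[mu]_(x in `[a, b]) f x <= c * (b - a).
Proof.
move=> cf ab fc.
have -> : c * (b - a) = \int[mu]_(x in `[a, b]) (cst c) x.
  rewrite (Rintegral_cst mu)//=.
  rewrite lebesgue_measure_itv/= lte_fin.
  by case: ltgtP ab => // -> _; rewrite subrr.
apply: le_Rintegral => //.
- exact: continuous_integrable_itv.
- by apply: continuous_integrable_itv => x; exact: cvg_cst.
Qed.

Lemma lipschitz_continuous f (K : R) :
  (forall x y, `|f x - f y| <= K * `|x - y|) -> continuous f.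
Proof.
move=> fK x.
have K0 : 0 <= K.
  by have := le_trans (normr_ge0 _) (fK 1 0); rewrite subr0 normr1 mulr1.
apply/cvgrPdist_lt => e e0; near=> y.
apply: le_lt_trans (fK _ _) _.
(* K may be 0, so K + 1 is the constant by which e is divided. *)
apply: (@le_lt_trans _ _ ((K + 1) * `|x - y|)).
  by rewrite ler_wpM2r// lerDl.
rewrite mulrC -ltr_pdivlMr ?ltr_wpDl//; near: y.
by apply: cvgr_dist_lt => //; rewrite divr_gt0// ltr_wpDl.
Unshelve. all: by end_near. Qed.

End primitive_calculus.

(** * The primitives G and GG of the kernel g *)

Section double_primitive.
Context {R : realType}.
Variable g : R -> R.
Hypotheses (g_range : forall t, 0 < g t <= 1)
  (g_even : forall t, g (- t) = g t) (g_cont : continuous g)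
  (g_int : (\int[lebesgue_measure]_t (g t * `|t|)%:E < +oo)%E).
Local Notation mu := (@lebesgue_measure R).
Local Notation G := (primitive g).
Local Notation GG := (primitive (primitive g)).

(** Both bounds integrate 0 < g <= 1; monotonicity and the Lipschitz bound of G follow. *)
Let dG a b : 0 <= a -> a <= b -> 0 <= G b - G a <= b - a.
Proof.
move=> a0 ab; rewrite primitiveB//; apply/andP; split.
  rewrite -(mul0r (b - a)); apply: Rintegral_itv_ge => // x _.
  by have /andP[/ltW] := g_range x.
rewrite -[leRHS]mul1r; apply: Rintegral_itv_le => // x _.
by have /andP[] := g_range x.
Qed.

Let G_nd a b : 0 <= a -> a <= b -> G a <= G b.
Proof. by move=> a0 /(dG a0)/andP[]; rewrite subr_ge0. Qed.

Let G_ge0 a : 0 <= a -> 0 <= G a.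
Proof. by move=> a0; rewrite -(primitive0 g) G_nd. Qed.

Let GN t : G (- t) = - G t.
Proof. exact: primitive_even_odd. Qed.

(** By compactness g has a positive minimum on [0, a]. *)
Lemma primitive_gt0 a : 0 < a -> 0 < G a.
Proof.
move=> a0; have [x _ xmin] : exists2 x, x \in `[0, a] &
    forall y, y \in `[0, a] -> g x <= g y.
  by apply: EVT_min; [exact: ltW|exact: continuous_subspaceT].
have -> : G a = G a - G 0 by rewrite primitive0 subr0.
rewrite primitiveB ?(ltW a0)//.
apply: lt_le_trans (Rintegral_itv_ge (c := g x) g_cont (ltW a0) _).
  by rewrite subr0 mulr_gt0//; have /andP[] := g_range x.
by move=> y xy; apply: xmin.
Qed.

Let G_lip x y : `|G x - G y| <= 1 * `|x - y|.
Proof.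
rewrite mul1r; wlog xy : x y / x <= y => [H|].
  by case/orP: (le_total x y) => /H//; rewrite distrC (distrC x).
rewrite distrC (distrC x) [leRHS]ger0_norm ?subr_ge0//.
have [x0|x0] := leP 0 x.
  by have /andP[? ?] := dG x0 xy; rewrite ger0_norm.
(* For x < 0 <= y, oddness gives G y - G x = G y + G (- x) <= y - x; for two negative points it
   reflects the problem to the half-line. *)
have [y0|y0] := leP 0 y.
  have Nx0 : 0 <= - x by rewrite oppr_ge0 ltW.
  have /andP[_ h1] := dG (lexx 0) y0; have /andP[_ h2] := dG (lexx 0) Nx0.
  move: h1 h2 (G_ge0 y0) (G_ge0 Nx0); rewrite GN primitive0 => *.
  by rewrite ger0_norm; lra.
have := @dG (- y) (- x); rewrite !GN lerN2 oppr_ge0.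
by move=> /(_ (ltW y0) xy)/andP[? ?]; rewrite ger0_norm; lra.
Qed.

Lemma primitive_continuous : continuous G.
Proof. exact: lipschitz_continuous G_lip. Qed.

Let GGN t : GG (- t) = GG t.
Proof. by apply: primitive_odd_even => //; exact: primitive_continuous. Qed.

Lemma primitive2_abs t : GG `|t| = GG t.
Proof. by case: (ger0P t) => _; rewrite ?GGN. Qed.

Lemma primitive2_nd a b : 0 <= a -> a <= b -> GG a <= GG b.
Proof.
move=> a0 ab; rewrite -subr_ge0 primitiveB//; last exact: primitive_continuous.
rewrite -(mul0r (b - a)); apply: Rintegral_itv_ge => //.
  exact: primitive_continuous.
by move=> x /andP[ax _]; apply: G_ge0; exact: le_trans ax.
Qed.

(** GG has slope G, which is nondecreasing, hence at least G c to the right of c. *)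
Lemma primitive2_convex a b c : 0 <= c -> c <= a -> a <= b ->
  G c * (b - a) <= GG b - GG a.
Proof.
move=> c0 ca ab; rewrite primitiveB ?(le_trans c0)//; last first.
  exact: primitive_continuous.
apply: Rintegral_itv_ge => //; first exact: primitive_continuous.
by move=> x /andP[ax _]; apply: G_nd => //; exact: le_trans ax.
Qed.

(** An upper bound for G on the half-line: the 1 pays for [0, 1], where g <= 1, and the integral for
    the rest, where g t <= g t * |t|. *)
Definition primitive_bound : R := 1 + fine (\int[mu]_t (g t * `|t|)%:E).

Let g_ge0 t : 0 <= g t. Proof. by have /andP[/ltW] := g_range t. Qed.

Let h_cont : continuous (fun t => g t * `|t|).
Proof.
move=> t; apply: (@continuousM _ _ g (fun x => `|x|)); first exact: g_cont.
exact: norm_continuous.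
Qed.

Lemma primitive_bound_gt0 : 0 < primitive_bound.
Proof.
rewrite ltr_wpDr// fine_ge0// integral_ge0// => t _.
by rewrite lee_fin mulr_ge0.
Qed.

Let G_le a : 0 <= a -> G a <= primitive_bound.
Proof.
move=> a0; have [a1|a1] := leP a 1.
  have /andP[_] := dG (lexx 0) a0; rewrite primitive0 !subr0 => Ga.
  apply: le_trans Ga _; apply: le_trans a1 _.
  rewrite lerDl fine_ge0// integral_ge0// => t _.
  by rewrite lee_fin mulr_ge0.
have /andP[_] := dG (lexx 0) ler01; rewrite primitive0 !subr0 => G1.
have -> : G a = G 1 + (G a - G 1) by rewrite addrC subrK.
apply: lerD => //; rewrite primitiveB ?(ltW a1)//.
have h0 : (forall t, true -> 0 <= (g t * `|t|)%:E)%E.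
  by move=> t _; rewrite lee_fin mulr_ge0.
apply: (@le_trans _ _ (\int[mu]_(t in `[1, a]) (g t * `|t|))).
  apply: le_Rintegral => //; try exact: continuous_integrable_itv.
  move=> x /=; rewrite in_itv/= => /andP[x1 _]; rewrite ler_peMr//.
  by rewrite ger0_norm// (le_trans ler01).
apply: fine_le.
- by apply: integrable_fin_num => //; exact: continuous_integrable_itv.
- rewrite ge0_fin_numE//; apply: integral_ge0 => t _; exact: h0.
- apply: ge0_subset_integral => //; last by move=> t _; exact: h0.
  by apply/measurable_EFinP; exact: continuous_measurable_fun.
Qed.

(** Evenness and the reverse triangle inequality reduce to nonnegative arguments, where the slope G
    is at most [primitive_bound]. *)
Lemma primitive2_lipschitz x y :
  `|GG x - GG y| <= primitive_bound * `|x - y|.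
Proof.
rewrite -(primitive2_abs x) -(primitive2_abs y).
apply: (@le_trans _ _ (primitive_bound * `| `|x| - `|y| |)); last first.
  by rewrite ler_wpM2l ?(ltW primitive_bound_gt0)// ler_dist_dist.
have := normr_ge0 y; have := normr_ge0 x.
move: `|x| `|y| => {x y} x y; wlog xy : x y / x <= y => [H x0 y0|x0 y0].
  by case/orP: (le_total x y) => /H; [exact|rewrite distrC (distrC y); exact].
rewrite distrC (distrC x) [X in _ * X]ger0_norm ?subr_ge0//.
rewrite ger0_norm ?subr_ge0 ?primitive2_nd// primitiveB//; last first.
  exact: primitive_continuous.
apply: Rintegral_itv_le => //; first exact: primitive_continuous.
by move=> t /andP[xt _]; apply: G_le; exact: le_trans xt.
Qed.

Lemma primitive2_continuous : continuous GG.
Proof. exact: lipschitz_continuous primitive2_lipschitz. Qed.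

End double_primitive.

(** * The Euclidean norm and its coordinates *)

Section euclidean_norm.
Context {R : realType} {n : nat}.
Implicit Types x y : 'rV[R]_n.

Lemma enorm_ge0 x : 0 <= enorm x.
Proof. exact: sqrtr_ge0. Qed.

Lemma enormN x : enorm (- x) = enorm x.
Proof.
by congr (Num.sqrt _); apply: eq_bigr => i _; rewrite mxE sqrrN.
Qed.

Lemma enorm_distC x y : enorm (x - y) = enorm (y - x).
Proof. by rewrite -opprB enormN. Qed.

Lemma enorm_coord x i : `|x ord0 i| <= enorm x.
Proof.
rewrite -sqrtr_sqr ler_sqrt; last by apply: sumr_ge0 => j _; exact: sqr_ge0.
rewrite (bigD1 i)//= lerDl; apply: sumr_ge0 => j _; exact: sqr_ge0.
Qed.

Lemma enorm_gt0 x i : x ord0 i != 0 -> 0 < enorm x.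
Proof. by move=> xi; apply: lt_le_trans (enorm_coord x i); rewrite normr_gt0. Qed.

Lemma enorm_le_coord x (c : R) : 0 <= c -> (forall i, `|x ord0 i| <= c) ->
  enorm x <= Num.sqrt n%:R * c.
Proof.
move=> c0 xc; rewrite -[X in _ * X](ger0_norm c0) -sqrtr_sqr -sqrtrM//.
rewrite ler_sqrt ?mulr_ge0 ?sqr_ge0//.
apply: (@le_trans _ _ (\sum_(i < n) c ^+ 2)).
  by apply: ler_sum => i _; rewrite -[leLHS]real_normK ?num_real// lerXn2r ?nnegrE.
by rewrite sumr_const card_ord mulr_natl.
Qed.

(** Exhibits a cube of side d / sqrt n inside the annulus. Cubes replace annuli and shells
    throughout because their measure is a product of lengths. *)
Lemma enorm_annulus x (d : R) : (0 < n)%N -> 0 < d ->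
  (forall i, d / Num.sqrt n%:R < x ord0 i < 2 * d / Num.sqrt n%:R) ->
  d < enorm x < 2 * d.
Proof.
move=> n0 d0 H; pose c := d / Num.sqrt n%:R.
have sn0 : 0 < Num.sqrt n%:R :> R by rewrite sqrtr_gt0 ltr0n.
have c0 : 0 < c by rewrite divr_gt0.
have cE : d ^+ 2 = \sum_(i < n) c ^+ 2.
  rewrite sumr_const card_ord /c exprMn exprVn sqr_sqrtr ?ler0n//.
  by rewrite -[RHS]mulr_natr mulfVK// pnatr_eq0 -lt0n.
have lt_sum (F F' : 'I_n -> R) : (forall i, F i < F' i) ->
    \sum_(i < n) F i < \sum_(i < n) F' i.
  move=> FF; apply: ltr_sum => //; apply/hasP.
  (* A sum of strict inequalities is strict only if there is at least one term. *)
  by exists (Ordinal n0); rewrite ?mem_index_enum.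
have d20 : 0 < 2 * d by rewrite mulr_gt0.
have xlo : d ^+ 2 < \sum_(i < n) x ord0 i ^+ 2.
  rewrite cE; apply: lt_sum => i; have /andP[ci _] := H i.
  by rewrite ltrXn2r ?(ltW c0).
have xhi : \sum_(i < n) x ord0 i ^+ 2 < (2 * d) ^+ 2.
  rewrite exprMn cE mulr_sumr; apply: lt_sum => i; have /andP[ci] := H i.
  rewrite -mulrA -exprMn => ic.
  have xi0 : 0 < x ord0 i by exact: lt_trans ci.
  by rewrite ltrXn2r ?(ltW xi0).
apply/andP; split.
  rewrite -[ltLHS](gtr0_norm d0) -sqrtr_sqr ltr_sqrt//.
  by rewrite (le_lt_trans _ xlo)// sqr_ge0.
by rewrite -[ltRHS](gtr0_norm d20) -sqrtr_sqr ltr_sqrt// exprn_gt0.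
Qed.

End euclidean_norm.

(** * Cubes and open sets for the Lebesgue measure of R^n *)

Section lebesgue_rV_theory.
Context {R : realType} {n : nat}.
Local Notation mu := (@lebesgue_rV_measure R n).

Lemma lebesgue_rV_measurable (A : set 'rV[R]_n) :
  measurable A -> measurable (A : set (lebesgue_rV R n)).
Proof. exact: caratheodory_measurable_mu_ext. Qed.

Lemma lebesgue_rV_measureE (A : set 'rV[R]_n) :
  measurable A -> mu A = borel_lebesgue n A.
Proof. exact: measurable_mu_extE. Qed.

Lemma measurable_lebesgue_rV_coord (i : 'I_n) :
  measurable_fun [set: lebesgue_rV R n]
    (fun x : lebesgue_rV R n => (x : 'rV[R]_n) ord0 i).
Proof.
move=> _ Y mY; apply: lebesgue_rV_measurable; exact: measurable_rV_coord.
Qed.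

(** Covers both kinds of cubes in use: centred at x when a = - b, and off to one side, within an
    annulus around x, when 0 < a. *)
Definition box (x : 'rV[R]_n) (a b : R) : set 'rV[R]_n :=
  [set y | forall i, a < y ord0 i - x ord0 i < b].

Lemma measurable_box x a b : measurable (box x a b).
Proof.
have -> : box x a b = \bigcap_(i in [set: 'I_n])
    ((fun y : 'rV[R]_n => y ord0 i) @^-1` `]a + x ord0 i, b + x ord0 i[).
  apply/seteqP; split => y /= H i; first move=> _.
    by have := H i; rewrite /= in_itv/= ltrBrDr ltrBlDr.
  by have := H i I; rewrite /= in_itv/= ltrBrDr ltrBlDr.
apply: fin_bigcap_measurable => // i _; rewrite -[X in measurable X]setTI.
exact: measurable_rV_coord.
Qed.

Lemma lebesgue_rV_box x a b : a <= b -> mu (box x a b) = ((b - a) ^+ n)%:E.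
Proof.
move=> ab; rewrite lebesgue_rV_measureE; last exact: measurable_box.
have -> : box x a b =
    [set y | forall i, `]a + x ord0 i, b + x ord0 i[%classic (y ord0 i)].
  by apply/seteqP; split => y /= H i; have := H i; rewrite /= in_itv/= ltrBrDr ltrBlDr.
rewrite (borel_lebesgue_box (B := fun i => `]a + x ord0 i, b + x ord0 i[%classic))//.
rewrite (eq_bigr (fun=> (b - a)%:E)); last first.
  move=> i _; rewrite lebesgue_measure_itv/= lte_fin ltrD2r.
  have [_|ba] := ltP a b; first by rewrite -EFinD; congr EFin; lra.
  by congr EFin; lra.
by rewrite prodEFin prodr_const card_ord.
Qed.

(** The sigma-algebra is generated by the coordinates, not by the topology. An open set is the
    countable union of the cubes it contains that have a rational centre and half-side 1 / (k +
    1). *)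
Lemma open_measurable_rV (A : set 'rV[R]_n) : open A -> measurable A.
Proof.
move=> oA.
pose I : Type := ('rV[rat]_n * nat)%type.
pose B (p : I) := box (map_mx ratr p.1) (- p.2.+1%:R^-1) (p.2.+1%:R^-1).
have -> : A = \bigcup_(p in [set p | B p `<=` A]) B p.
  apply/seteqP; split=> [x Ax|x [p /= pA]]; last exact: pA.
  have /nbhs_ballP[e /= e0 eA] := open_nbhs_nbhs (conj oA Ax).
  (* Twice the half-side: once from x to the rational centre, once from there to y. *)
  have [k ke] : exists k, 2 * k.+1%:R^-1 < e.
    have [k] := ltr_add_invr (divr_gt0 e0 (@ltr0Sn R 1)).
    rewrite add0r ltr_pdivlMr// mulrC => ke; by exists k.
  have r0 : 0 < k.+1%:R^-1 :> R by rewrite invr_gt0.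
  have /choice[q qP] : forall i, exists q : rat, `|x ord0 i - ratr q| < k.+1%:R^-1.
    move=> i.
    have [|q] := @rat_in_itvoo R (x ord0 i - k.+1%:R^-1) (x ord0 i + k.+1%:R^-1).
      by rewrite ltrD2l gtrN.
    by rewrite in_itv/= -ltr_distlC; exists q.
  exists (\row_i q i, k); last first.
    move=> i; rewrite !mxE; have := qP i; rewrite ltr_norml => /andP[] -> ->//.
  move=> y By; apply: eA; split=> // i j; rewrite (ord1 i) /ball/=.
  apply: le_lt_trans ke; have := By j; rewrite !mxE/= -ltr_norml => yq.
  rewrite mulr_natl mulr2n -(subrK (ratr (q j)) (x ord0 j)) -addrA.
  apply: le_trans (ler_normD _ _) _; apply: lerD; first exact/ltW/qP.
  by rewrite distrC ltW.
rewrite bigcup_mkcond; apply: countable_bigcupT_measurable => [|p].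
  exact: countableP.
by case: ifP => // _; exact: measurable_box.
Qed.

End lebesgue_rV_theory.

(** * Measurability and cube integrals on pairs of points *)

Section product_measurability.
Context {R : realType} {n : nat}.
Local Notation T := (lebesgue_rV R n).
Local Notation mu := (@lebesgue_rV_measure R n).

Lemma measurable_rV_coordB (i : 'I_n) :
  measurable_fun [set: T * T]
    (fun z : T * T => ((z.2 : 'rV[R]_n) ord0 i - (z.1 : 'rV[R]_n) ord0 i)).
Proof.
by apply: measurable_funB;
  apply: (measurableT_comp (measurable_lebesgue_rV_coord i)).
Qed.

Lemma measurable_enormB :
  measurable_fun [set: T * T]
    (fun z : T * T => enorm ((z.1 : 'rV[R]_n) - (z.2 : 'rV[R]_n))).
Proof.
have msqrt : measurable_fun [set: R] (@Num.sqrt R).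
  by apply: continuous_measurable_fun; exact: sqrt_continuous.
apply: (measurableT_comp msqrt).
apply: measurable_sum => i; apply: measurable_funX.
apply: (eq_measurable_fun (fun z : T * T =>
  - ((z.2 : 'rV[R]_n) ord0 i - (z.1 : 'rV[R]_n) ord0 i))).
  by move=> z _ /=; rewrite !mxE opprB.
by apply: measurableT_comp => //; exact: measurable_rV_coordB.
Qed.

Lemma measurable_box_pair (a b : R) :
  measurable [set z : T * T | box z.1 a b z.2].
Proof.
have -> : [set z : T * T | box z.1 a b z.2] = \bigcap_(i in [set: 'I_n])
    ((fun z : T * T => ((z.2 : 'rV[R]_n) ord0 i - (z.1 : 'rV[R]_n) ord0 i))
      @^-1` `]a, b[).
  apply/seteqP; split => z /= H i; first move=> _.
    by have := H i; rewrite /= in_itv.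
  by have := H i I; rewrite /= in_itv.
apply: fin_bigcap_measurable => // i _; rewrite -[X in measurable X]setTI.
exact: measurable_rV_coordB.
Qed.

(** On nonnegative reals, 0 included, the inverse is the power of exponent -1, which is
    measurable. *)
Lemma measurable_fun_divr d (U : measurableType d) (f h : U -> R) :
  measurable_fun setT f -> measurable_fun setT h -> (forall x, 0 <= h x) ->
  measurable_fun setT (fun x => f x / h x).
Proof.
move=> mf mh h0; apply: measurable_funM => //.
apply: (eq_measurable_fun (fun x => h x `^ (-1))).
  by move=> x _; rewrite powR_inv1.
exact: (measurableT_comp (measurable_powR (-1)) mh).
Qed.

Lemma box_sym (r : R) (x y : 'rV[R]_n) : box x (- r) r y -> box y (- r) r x.
Proof.
by move=> H i; have := H i; rewrite -!ltr_norml distrC.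
Qed.

Local Open Scope ereal_scope.

(** Tonelli, integrating in y first: the volume of the cube attached to x does not depend on x. *)
Lemma integral_box_pair1 (w : T -> R) (a b : R) : (a <= b)%R ->
  measurable_fun setT w -> (forall x, 0 <= w x)%R ->
  \int[mu \x mu]_z (w z.1 * \1_[set z | box z.1 a b z.2] z)%:E =
  ((b - a) ^+ n)%:E * \int[mu]_x (w x)%:E.
Proof.
move=> ab mw w0.
have mind : measurable_fun [set: T * T]
    (fun z => (\1_[set z : T * T | box z.1 a b z.2] z : R)).
  by apply: measurable_indic; exact: measurable_box_pair.
rewrite fubini_tonelli1; last 2 first.
- apply/measurable_EFinP; apply: measurable_funM.
    exact: measurableT_comp.
  by apply: measurable_indic; exact: measurable_box_pair.
- by move=> z; rewrite lee_fin mulr_ge0.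
have mEw : measurable_fun [set: T] (EFin \o w) by exact/measurable_EFinP.
have Ew0 x : [set: T] x -> 0 <= (EFin \o w) x by rewrite lee_fin.
have ab0 : (0 <= (b - a) ^+ n)%R by rewrite exprn_ge0// subr_ge0.
rewrite -(ge0_integralZl_EFin mu measurableT Ew0 mEw ab0).
apply: eq_integral => x _; rewrite /fubini_F/=.
under eq_integral do rewrite EFinM.
have mindx : measurable_fun [set: T]
    (EFin \o (fun y : T => \1_[set z : T * T | box z.1 a b z.2] (x, y) : R)).
  by apply/measurable_EFinP; exact: (measurableT_comp mind (pair1_measurable x)).
have indx0 y : [set: T] y ->
    0 <= (\1_[set z : T * T | box z.1 a b z.2] (x, y) : R)%:E.
  by rewrite lee_fin.
rewrite (ge0_integralZl_EFin mu measurableT indx0 mindx (w0 x)).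
rewrite muleC; congr (_ * _).
rewrite -(lebesgue_rV_box x ab) -[RHS]mul1e -[in RHS](setIT (box x a b)).
rewrite -integral_indic//; last first.
  by apply: lebesgue_rV_measurable; exact: measurable_box.
rewrite mul1e; apply: eq_integral => y _; congr (_%:E).
Qed.

(** For centred cubes the relation between x and y is symmetric, so exchanging the variables reduces
    to [integral_box_pair1]. *)
Lemma integral_box_pair2 (w : T -> R) (r : R) : (0 <= r)%R ->
  measurable_fun setT w -> (forall x, 0 <= w x)%R ->
  \int[mu \x mu]_z (w z.2 * \1_[set z | box z.1 (- r) r z.2] z)%:E =
  ((2 * r) ^+ n)%:E * \int[mu]_x (w x)%:E.
Proof.
move=> r0 mw w0.
have mind : measurable_fun [set: T * T]
    (fun z => (\1_[set z : T * T | box z.1 (- r) r z.2] z : R)).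
  by apply: measurable_indic; exact: measurable_box_pair.
have e0 (z : T * T) :
    0 <= (w z.2 * \1_[set z | box z.1 (- r) r z.2] z)%:E.
  by rewrite lee_fin mulr_ge0.
rewrite fubini_tonelli2//; last first.
  by apply/measurable_EFinP; apply: measurable_funM => //; exact: measurableT_comp.
have -> : (2 * r = r - - r)%R by ring.
rewrite -integral_box_pair1 ?ge0_cp// fubini_tonelli1; last 2 first.
- apply/measurable_EFinP; apply: measurable_funM => //; exact: measurableT_comp.
- by move=> z; rewrite lee_fin mulr_ge0.
apply: eq_integral => y _; rewrite /fubini_F/fubini_G/=.
apply: eq_integral => x _; congr (_ * _)%:E; rewrite !indicE; congr ((_ : bool)%:R).
by apply/idP/idP; rewrite !inE; exact: box_sym.
Qed.

End product_measurability.

(** * Dyadic estimate of the long-range interaction *)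

Section dyadic_tail.
Context {R : realType} {n : nat}.
Variable s : R.
Hypothesis s_gt0 : 0 < s.
Local Notation T := (lebesgue_rV R n).
Local Notation mu := (@lebesgue_rV_measure R n).
Local Notation q := (2 `^ (- s)).

Let q_gt0 : 0 < q. Proof. by rewrite powR_gt0. Qed.

Lemma powR2N_lt1 : q < 1.
Proof.
rewrite powRN invf_lt1 ?powR_gt0//.
have /= := @gt0_ltr_powR R s s_gt0 1 2; rewrite powR1.
by apply; rewrite ?nnegrE ?ltr1n.
Qed.

(** The size of the kernel on the k-th shell times the volume of the enclosing cube: the powers of
    order n cancel and a geometric sequence of ratio 2^(-s) remains. *)
Lemma dyadic_coef (rho : R) (k : nat) : 0 < rho ->
  (2 ^+ k * rho) `^ (- (n%:R + s)) * (2 * (2 ^+ k.+1 * rho)) ^+ n =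
  4 ^+ n * rho `^ (- s) * q ^+ k.
Proof.
move=> r0; set m := 2 ^+ k * rho.
have m0 : 0 < m by rewrite mulr_gt0// exprn_gt0.
have -> : 2 * (2 ^+ k.+1 * rho) = 4 * m by rewrite /m exprS; ring.
have -> : m `^ (- (n%:R + s)) = (m ^+ n)^-1 * m `^ (- s).
  rewrite opprD powRD; last by apply/implyP => _; rewrite gt_eqF.
  by congr (_ * _); rewrite powRN powR_mulrn// ltW.
rewrite [(4 * m) ^+ n]exprMn.
have mn0 : m ^+ n != 0 by rewrite expf_eq0 gt_eqF// andbF.
have -> : m `^ (- s) = rho `^ (- s) * q ^+ k.
  rewrite /m powRM ?exprn_ge0 ?ltW// mulrC; congr (_ * _).
  rewrite -(powR_mulrn k (ler0n R 2)) -(powR_mulrn k (powR_ge0 2 (- s))).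
  by rewrite -!powRrM; congr (_ `^ _); exact: mulrC.
move: mn0; move: (m ^+ n) (4 ^+ n) (rho `^ (- s)) (q ^+ k) => a b c e a0.
by field.
Qed.

Lemma dyadic_scale (rho r : R) : 0 < rho -> rho <= r ->
  exists k : nat, 2 ^+ k * rho <= r < 2 ^+ k.+1 * rho.
Proof.
move=> r0 rr.
have ex : exists k : nat, r < 2 ^+ k.+1 * rho.
  exists (Num.bound (r / rho)).
  rewrite -ltr_pdivrMr//; apply: lt_trans (archi_boundP _) _.
    by rewrite divr_ge0 ?ltW// (lt_le_trans r0).
  by rewrite -natrX ltr_nat (ltn_trans (ltnSn _))// ltn_expl.
(* The least such k works: its predecessor fails, which is the lower bound; at 0 the lower bound is
   rho <= r. *)
case: (ex_minnP ex) => -[|k] kr kmin; first by exists 0%N; rewrite expr0 mul1r rr kr.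
exists k.+1; rewrite kr andbT leNgt; apply/negP => /kmin.
by rewrite ltnn.
Qed.

Lemma dyadic_box (rho : R) (x y : 'rV[R]_n) : 0 < rho ->
  rho <= enorm (x - y) ->
  exists k : nat, box x (- (2 ^+ k.+1 * rho)) (2 ^+ k.+1 * rho) y /\
    enorm (x - y) `^ (- (n%:R + s)) <= (2 ^+ k * rho) `^ (- (n%:R + s)).
Proof.
move=> r0 rr; have [k /andP[kr rk]] := dyadic_scale r0 rr.
exists k; split.
  move=> i; rewrite -ltr_norml distrC; apply: le_lt_trans rk.
  by have := enorm_coord (x - y) i; rewrite !mxE.
have m0 : 0 < 2 ^+ k * rho by rewrite mulr_gt0// exprn_gt0.
rewrite !powRN lef_pV2 ?posrE ?powR_gt0//; last exact: lt_le_trans kr.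
apply: ge0_ler_powR => //; first by rewrite addr_ge0// ltW.
  by rewrite nnegrE ltW.
by rewrite nnegrE enorm_ge0.
Qed.

Local Open Scope ereal_scope.

(* Dominates (w x + w y) |x - y|^(-n-s) on |x - y| >= rho: the k-th dyadic shell
   is enlarged to a cube, on which the power takes its largest shell value. *)
Definition tail_kernel (w : T -> R) (rho : R) (z : T * T) : \bar R :=
  \sum_(k <oo) ((2 ^+ k * rho) `^ (- (n%:R + s)) *
    ((w z.1 + w z.2) *
     \1_[set z : T * T | box z.1 (- (2 ^+ k.+1 * rho)) (2 ^+ k.+1 * rho) z.2] z))%:E.

Variables (w : T -> R) (rho : R).
Hypotheses (mw : measurable_fun setT w) (w0 : forall x, (0 <= w x)%R)
  (rho_gt0 : (0 < rho)%R).

Let c_ (k : nat) : R := (2 ^+ k * rho) `^ (- (n%:R + s)).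
Let r_ (k : nat) : R := (2 ^+ k.+1 * rho)%R.
Let f_ (k : nat) (z : T * T) : R := (c_ k *
    ((w z.1 + w z.2) * \1_[set z : T * T | box z.1 (- r_ k) (r_ k) z.2] z))%R.

Let r_ge0 k : (0 <= r_ k)%R. Proof. by rewrite mulr_ge0 ?exprn_ge0 ?ltW. Qed.

Let f_ge0 k z : 0 <= (f_ k z)%:E.
Proof. by rewrite lee_fin mulr_ge0 ?powR_ge0// mulr_ge0// addr_ge0. Qed.

Let mf_ k : measurable_fun setT (EFin \o f_ k).
Proof.
apply/measurable_EFinP; apply: measurable_funM => //.
apply: measurable_funM.
  by apply: measurable_funD; exact: measurableT_comp.
by apply: measurable_indic; exact: measurable_box_pair.
Qed.

Lemma tail_kernel_ge0 z : 0 <= tail_kernel w rho z.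
Proof. by apply: nneseries_ge0 => k _ _; exact: f_ge0. Qed.

Lemma measurable_tail_kernel : measurable_fun setT (tail_kernel w rho).
Proof.
apply: (ge0_emeasurable_sum (h := fun k z => (f_ k z)%:E)) => [k z _ _|k _].
  exact: f_ge0.
exact: mf_.
Qed.

(** The term of the shell containing the pair suffices, all others being nonnegative. *)
Lemma le_tail_kernel z : (rho <= enorm ((z.1 : 'rV[R]_n) - (z.2 : 'rV[R]_n)))%R ->
  ((w z.1 + w z.2) * enorm ((z.1 : 'rV[R]_n) - (z.2 : 'rV[R]_n)) `^ (- (n%:R + s)))%:E
    <= tail_kernel w rho z.
Proof.
move=> rz; have [k [kb kr]] := dyadic_box rho_gt0 rz.
apply: (@le_trans _ _ (f_ k z)%:E).
  rewrite lee_fin /f_ indicE mem_set// mulr1 mulrC ler_wpM2r//.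
  by rewrite addr_ge0.
rewrite /tail_kernel (nneseriesD1 (n := k))//; last by move=> *; exact: f_ge0.
by rewrite leeDl// nneseries_ge0// => *; exact: f_ge0.
Qed.

(** The factor 2 counts the terms w z.1 and w z.2, which integrate alike; 1 / (1 - q) sums the
    geometric series left by [dyadic_coef]. *)
Lemma integral_tail_kernel :
  \int[mu \x mu]_z tail_kernel w rho z <=
  (2 * 4 ^+ n * rho `^ (- s) / (1 - q))%:E * \int[mu]_x (w x)%:E.
Proof.
set W := \int[mu]_x (w x)%:E.
have W0 : 0 <= W by apply: integral_ge0 => x _; rewrite lee_fin.
have If k : \int[mu \x mu]_z (f_ k z)%:E =
    (2 * 4 ^+ n * rho `^ (- s) * q ^+ k)%:E * W.
  have e1 z : 0 <= (w z.1 * \1_[set z : T * T | box z.1 (- r_ k) (r_ k) z.2] z)%:E.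
    by rewrite lee_fin mulr_ge0.
  have e2 z : 0 <= (w z.2 * \1_[set z : T * T | box z.1 (- r_ k) (r_ k) z.2] z)%:E.
    by rewrite lee_fin mulr_ge0.
  have mi : measurable_fun setT
      (fun z => \1_[set z : T * T | box z.1 (- r_ k) (r_ k) z.2] z : R).
    by apply: measurable_indic; exact: measurable_box_pair.
  have m1 : measurable_fun setT (fun z : T * T =>
      (w z.1 * \1_[set z : T * T | box z.1 (- r_ k) (r_ k) z.2] z)%:E).
    by apply/measurable_EFinP; apply: measurable_funM => //; exact: measurableT_comp.
  have m2 : measurable_fun setT (fun z : T * T =>
      (w z.2 * \1_[set z : T * T | box z.1 (- r_ k) (r_ k) z.2] z)%:E).
    by apply/measurable_EFinP; apply: measurable_funM => //; exact: measurableT_comp.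
  transitivity (\int[mu \x mu]_z ((c_ k)%:E *
     ((w z.1 * \1_[set z : T * T | box z.1 (- r_ k) (r_ k) z.2] z)%:E +
      (w z.2 * \1_[set z : T * T | box z.1 (- r_ k) (r_ k) z.2] z)%:E))).
    by apply: eq_integral => z _; rewrite /f_ mulrDl.
  rewrite ge0_integralZl//; last 3 first.
  - exact: emeasurable_funD.
  - by move=> z _; rewrite adde_ge0.
  - by rewrite lee_fin powR_ge0.
  rewrite ge0_integralD// integral_box_pair1//; last first.
    by rewrite lerNl (le_trans _ (r_ge0 k))// oppr_le0.
  rewrite integral_box_pair2//.
  have -> : (r_ k - - r_ k = 2 * r_ k)%R by ring.
  have r2 : 0 <= ((2 * r_ k) ^+ n)%:E by rewrite lee_fin exprn_ge0// mulr_ge0.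
  rewrite -ge0_muleDl// muleA -EFinD -EFinM.
  congr (_%:E * _); rewrite -[LHS]mulr1 -[RHS]mulr1.
  have := dyadic_coef k rho_gt0; rewrite -/(c_ k) -/(r_ k) => E.
  by rewrite mulrDr E; ring.
rewrite /tail_kernel.
rewrite (@integral_nneseries _ _ _ _ _ measurableT (fun k z => (f_ k z)%:E))//.
rewrite (eq_eseriesr (fun k _ => If k)).
apply: lime_le.
  apply: is_cvg_nneseries => k _ _.
  by rewrite mule_ge0// lee_fin !mulr_ge0 ?exprn_ge0 ?powR_ge0.
apply: nearW => N; rewrite -ge0_sume_distrl; last first.
  by move=> k _; rewrite lee_fin !mulr_ge0 ?exprn_ge0 ?powR_ge0.
apply: lee_wpmul2r => //; rewrite sumEFin lee_fin -mulr_sumr.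
apply: ler_wpM2l; first by rewrite !mulr_ge0 ?exprn_ge0 ?powR_ge0.
have := @geometric_le_lim R N 1 q ler01 q_gt0.
rewrite ger0_norm ?(ltW q_gt0)// div1r.
move=> /(_ powR2N_lt1); apply: le_trans; rewrite /series/= le_eqVlt; apply/orP; left.
by apply/eqP; apply: eq_bigr => k _; rewrite /geometric/= mul1r.
Qed.

End dyadic_tail.

(** * Diameter and neighbourhoods of a bounded open set *)

Section diameter.
Context {R : realType} {n : nat}.
Implicit Types (x y : 'rV[R]_n) (Om : set 'rV[R]_n).

Let diam_set Om := [set enorm (p.1 - p.2) | p in Om `*` Om].

Lemma has_ubound_diam Om : bounded_set Om -> has_ubound (diam_set Om).
Proof.
(* Boundedness provides bounds strictly above M only, hence M + 1. *)
move=> [M [_ /(_ (M + 1))]]; rewrite ltrDl ltr01 => /(_ isT) HM.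
pose c := `|M + 1| + `|M + 1|.
exists (Num.sqrt n%:R * c) => _ [[x y] [/= Ox Oy] <-].
apply: enorm_le_coord => [|i]; first by rewrite addr_ge0.
rewrite !mxE; apply: le_trans (ler_normB _ _) _.
have H z : Om z -> `|z ord0 i| <= `|M + 1|.
  move=> /HM zM; apply: le_trans (ler_norm _); apply: le_trans zM.
  rewrite [leRHS]/Num.norm/= mx_normrE.
  exact: (le_bigmax_cond _ (fun p : 'I_1 * 'I_n => `|z p.1 p.2|) (j := (ord0, i))).
by apply: lerD; exact: H.
Qed.

Lemma enorm_le_diam Om x y : bounded_set Om -> Om x -> Om y ->
  enorm (x - y) <= diam Om.
Proof.
move=> bO Ox Oy; apply: ub_le_sup; first exact: has_ubound_diam.
by exists (x, y).
Qed.

Lemma diam_gt0 Om : (0 < n)%N -> open Om -> bounded_set Om -> Om !=set0 ->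
  0 < diam Om.
Proof.
move=> n0 oO bO [x Ox].
have /nbhs_ballP[e /= e0 eO] := open_nbhs_nbhs (conj oO Ox).
(* A second point of [Om]: in the sup norm every coordinate may be shifted at once. *)
pose y : 'rV[R]_n := \row_i (x ord0 i + e / 2).
have Oy : Om y.
  apply: eO; split => // i j; rewrite (ord1 i) /ball/= mxE opprD addNKr normrN.
  by rewrite gtr0_norm ?divr_gt0// ltr_pdivrMr// mulr_natr mulr2n ltrDl.
apply: lt_le_trans (enorm_le_diam bO Oy Ox).
apply: (@enorm_gt0 _ _ _ (Ordinal n0)); rewrite !mxE addrAC subrr add0r.
by rewrite gt_eqF// divr_gt0.
Qed.

Lemma notin_neighborhood Om x y (r : R) : Om x -> ~ neighborhood Om r y ->
  r <= enorm (x - y).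
Proof.
move=> Ox /negP; rewrite -leNgt -lee_fin => /le_trans; apply.
by apply: ereal_inf_lbound; exists x => //; rewrite enorm_distC.
Qed.

End diameter.

(** * Truncation from above inside the domain *)

Section truncation.
Context {R : realType} {n : nat}.
Variables (Om : set 'rV[R]_n) (u : 'rV[R]_n -> R) (M : R).
Hypothesis M_ge0 : 0 <= M.
Implicit Types x y : 'rV[R]_n.

(** Patched by 0 off [Om], so that subtracting it from u keeps the exterior data. *)
Definition excess : 'rV[R]_n -> R := (fun x => Num.max (u x - M) 0) \_ Om.

Definition truncation : 'rV[R]_n -> R := fun x => u x - excess x.

Lemma excess_in x : Om x -> excess x = Num.max (u x - M) 0.
Proof. by move=> Ox; rewrite /excess patchE mem_set. Qed.

Lemma excess_out x : ~ Om x -> excess x = 0.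
Proof. by move=> Ox; rewrite /excess patchE memNset. Qed.

Lemma excess_ge0 x : 0 <= excess x.
Proof. by rewrite /excess patchE; case: ifP => // _; rewrite le_max lexx orbT. Qed.

Lemma truncation_out x : ~ Om x -> truncation x = u x.
Proof. by move=> Ox; rewrite /truncation excess_out// subr0. Qed.

Lemma excess_neq0 x : excess x != 0 -> Om x /\ excess x = u x - M.
Proof.
have [Ox|Ox] := pselect (Om x); last by rewrite excess_out// eqxx.
rewrite excess_in//; split => //; move: H.
by case: (leP (u x - M) 0) => //; rewrite eqxx.
Qed.

Lemma excess_le x : excess x <= `|u x|.
Proof.
have [->|/excess_neq0[_ ->]] := eqVneq (excess x) 0; first exact: normr_ge0.
by rewrite (le_trans _ (ler_norm _))// gerBl.
Qed.

(** Where the truncation acts, its value M satisfies 0 <= M <= u x. This keeps the competitor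
    integrable. *)
Lemma normr_truncation_le x : `|truncation x| <= `|u x|.
Proof.
rewrite /truncation; have [->|w0] := eqVneq (excess x) 0; first by rewrite subr0.
have [_ wE] := excess_neq0 w0; have := excess_ge0 x; rewrite wE subr_ge0 => Mu.
rewrite opprB addrC subrK (ger0_norm M_ge0).
by rewrite (le_trans Mu)// ler_norm.
Qed.

(** t |-> min(t, M) is 1-Lipschitz. Both points must be in [Om], since values outside are not
    truncated. *)
Lemma truncation_contraction x y : Om x -> Om y ->
  `|truncation x - truncation y| <= `|u x - u y|.
Proof.
move=> Ox Oy; rewrite /truncation !excess_in//.
case: (leP (u x - M) 0) => ux; case: (leP (u y - M) 0) => uy; rewrite ?subr0//.
- have -> : u y - (u y - M) = M by ring.
  by rewrite distrC (distrC (u x)) !ger0_norm; lra.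
- have -> : u x - (u x - M) = M by ring.
  by rewrite !ger0_norm; lra.
- have -> : u x - (u x - M) - (u y - (u y - M)) = 0 by ring.
  by rewrite normr0.
Qed.

End truncation.

(** * Pointwise estimates of the energy difference *)

Section integrand.
Context {R : realType} {n : nat}.
Variables (s : R) (g : R -> R).
Hypothesis s_gt0 : 0 < s.
Hypotheses (g_range : forall t, 0 < g t <= 1)
  (g_even : forall t, g (- t) = g t) (g_cont : continuous g)
  (g_int : (\int[lebesgue_measure]_t (g t * `|t|)%:E < +oo)%E).
Local Notation GG := (primitive (primitive g)).
Local Notation K := (primitive_bound g).
Implicit Types (x y : 'rV[R]_n) (u v : 'rV[R]_n -> R).

Definition energy_gap u v x y : R :=
  (GG ((u x - u y) / enorm (x - y)) - GG ((v x - v y) / enorm (x - y))) /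
  enorm (x - y) `^ (n%:R - 1 + s).

(** Follows from the evenness of GG, and lets a point of [Om] always be taken first. *)
Lemma energy_gapC u v x y : energy_gap u v x y = energy_gap u v y x.
Proof.
rewrite /energy_gap (enorm_distC x y); congr (_ / _).
have E (f : 'rV[R]_n -> R) : GG ((f x - f y) / enorm (y - x)) =
    GG ((f y - f x) / enorm (y - x)).
  rewrite -[LHS](primitive2_abs g_range g_even g_cont).
  rewrite -[RHS](primitive2_abs g_range g_even g_cont).
  by rewrite !normrM distrC.
by rewrite !E.
Qed.

Lemma energy_gap_ge0 u v x y : `|v x - v y| <= `|u x - u y| ->
  0 <= energy_gap u v x y.
Proof.
move=> vu; apply: divr_ge0; last exact: powR_ge0.
rewrite subr_ge0 -(primitive2_abs g_range g_even g_cont (_ / _)).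
rewrite -[leRHS](primitive2_abs g_range g_even g_cont).
by apply: primitive2_nd => //; rewrite !normrM ler_wpM2r.
Qed.

(** One power of r belongs to the difference quotient, the rest to the weight of exponent n - 1 +
    s. *)
Let powr_split (r : R) : 0 < r ->
  r `^ (- (n%:R + s)) = r^-1 / r `^ (n%:R - 1 + s).
Proof.
move=> r0; rewrite powRN -invfM; congr (_^-1).
rewrite -[X in X * _](powRr1 (ltW r0)) -powRD; last first.
  by apply/implyP => _; rewrite gt_eqF.
by congr (_ `^ _); ring.
Qed.

Lemma energy_gap_bound u v x y :
  `|energy_gap u v x y| <=
  K * (`|(u x - u y) - (v x - v y)| * enorm (x - y) `^ (- (n%:R + s))).
Proof.
have K0 := primitive_bound_gt0 g_range.
have := enorm_ge0 (x - y); rewrite le_eqVlt => /predU1P[r0|r0].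
  (* On the diagonal the convention 0^-1 = 0 makes both quotients, hence the gap, vanish. *)
  rewrite /energy_gap -r0 !invr0 !mulr0 subrr mul0r normr0.
  by rewrite !mulr_ge0// ?powR_ge0// ltW.
rewrite powr_split// !mulrA /energy_gap normrM.
rewrite (ger0_norm (x := _^-1)) ?invr_ge0 ?powR_ge0//.
rewrite ler_wpM2r ?invr_ge0 ?powR_ge0//.
apply: le_trans (primitive2_lipschitz g_range g_even g_cont g_int _ _) _.
by rewrite -mulrBl normrM (ger0_norm (x := _^-1)) ?invr_ge0 ?enorm_ge0// mulrA.
Qed.

(** The quotient of v is at least d / (2 d) = 1/2, so by convexity GG grows beyond it with slope at
    least G (1/2); the distance in the weight is then replaced by its bound 2 d. *)
Lemma energy_gap_lower u v x y (d : R) : 0 < d ->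
  d < enorm (x - y) < 2 * d -> d <= v x - v y -> v x - v y <= u x - u y ->
  primitive g (2^-1) * (2 * d) `^ (- (n%:R + s)) * ((u x - u y) - (v x - v y)) <=
  energy_gap u v x y.
Proof.
move=> d0 /andP[dr r2d] dv vu; set r := enorm (x - y) in dr r2d *.
have r0 : 0 < r by exact: lt_trans dr.
have c0 : 0 < primitive g 2^-1 by apply: primitive_gt0 => //; rewrite invr_gt0.
apply: (@le_trans _ _ (primitive g 2^-1 * r `^ (- (n%:R + s)) *
    ((u x - u y) - (v x - v y)))).
  rewrite ler_wpM2r ?subr_ge0// ler_wpM2l ?(ltW c0)// !powRN.
  rewrite lef_pV2 ?posrE ?powR_gt0 ?mulr_gt0//.
  by apply: ge0_ler_powR; rewrite ?nnegrE ?(ltW r0) ?(ltW r2d) ?addr_ge0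
    ?(ltW s_gt0) ?mulr_ge0 ?(ltW d0).
rewrite powr_split// /energy_gap -/r.
rewrite (_ : _ * _ * _ = primitive g 2^-1 *
  ((u x - u y) / r - (v x - v y) / r) / r `^ (n%:R - 1 + s)); last by ring.
rewrite ler_wpM2r ?invr_ge0 ?powR_ge0//.
apply: primitive2_convex => //; rewrite ?invr_ge0//.
- rewrite ler_pdivlMr// mulrC ler_pdivrMr//.
  by rewrite (le_trans (ltW r2d))// mulrC ler_wpM2r.
- by rewrite ler_wpM2r// invr_ge0 ltW.
Qed.

End integrand.

(** * Comparison of integrals *)

Section integral_comparison.
Local Open Scope ereal_scope.
Context d (X : measurableType d) (R : realType).
Variable mu : {measure set X -> \bar R}.

(* Unlike [ge0_le_integral], no measurability: the integral is a supremum over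
   simple functions. *)
Lemma ge0_le_integral_sup (D : set X) (f1 f2 : X -> \bar R) :
  (forall x, D x -> 0 <= f1 x) -> (forall x, D x -> f1 x <= f2 x) ->
  \int[mu]_(x in D) f1 x <= \int[mu]_(x in D) f2 x.
Proof.
move=> f10 f12; have f20 x : D x -> 0 <= f2 x.
  by move=> Dx; exact: le_trans (f10 x Dx) (f12 x Dx).
rewrite !ge0_integralE//; apply: ereal_sup_le => _ [h hf <-].
exists h => // x; apply: le_trans (hf x) _.
rewrite !patchE; case: ifPn => // xD; apply: f12; exact: set_mem.
Qed.

(** The chain is int A <= int f^+ <= int f^- <= int B, the middle step being int f <= 0. Only bounds
    on the two parts of f are asked for, not its integrability. *)
Lemma integral_le0_absorb (D : set X) (f : X -> R) (A B : X -> \bar R) :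
  measurable D -> measurable_fun D f ->
  measurable_fun D A -> measurable_fun D B ->
  (forall x, D x -> 0 <= A x) -> (forall x, D x -> 0 <= B x) ->
  \int[mu]_(x in D) (f x)%:E <= 0 -> \int[mu]_(x in D) B x < +oo ->
  {ae mu, forall x, D x -> A x <= (EFin \o f)^\+ x} ->
  {ae mu, forall x, D x -> (EFin \o f)^\- x <= B x} ->
  \int[mu]_(x in D) A x <= \int[mu]_(x in D) B x.
Proof.
move=> mD mf mA mB A0 B0 f0 Boo Af Bf.
have mEf : measurable_fun D (EFin \o f) by exact/measurable_EFinP.
have mp := measurable_funepos mEf; have mn := measurable_funeneg mEf.
have Ap : \int[mu]_(x in D) A x <= \int[mu]_(x in D) (EFin \o f)^\+ x.
  by apply: ae_ge0_le_integral.
have nB : \int[mu]_(x in D) (EFin \o f)^\- x <= \int[mu]_(x in D) B x.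
  by apply: ae_ge0_le_integral.
apply: le_trans Ap (le_trans _ nB).
have := f0; rewrite integralE sube_le0//.
Qed.

End integral_comparison.

(** * The truncation is an admissible competitor *)

Section truncation_admissible.
Context {R : realType} {n : nat}.
Local Notation T := (lebesgue_rV R n).
Local Notation mu := (@lebesgue_rV_measure R n).
Variables (s : R) (Om : set 'rV[R]_n) (u : 'rV[R]_n -> R) (M : R).
Hypotheses (oOm : open Om) (M_ge0 : 0 <= M) (Wu : calW s Om u).

Let mOm : measurable (Om : set T).
Proof. by apply: lebesgue_rV_measurable; exact: open_measurable_rV. Qed.

Let mu_ : measurable_fun [set: T] (u : T -> R). Proof. by case: Wu. Qed.

Lemma measurable_excess : measurable_fun [set: T] (excess Om u M : T -> R).
Proof.
apply/(measurable_restrictT _ mOm); apply: measurable_funTS.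
exact: (measurable_maxr (measurable_funB mu_ (measurable_cst _)) (measurable_cst _)).
Qed.

Lemma measurable_truncation :
  measurable_fun [set: T] (truncation Om u M : T -> R).
Proof. exact: (measurable_funB mu_ measurable_excess). Qed.

Lemma calW_truncation : calW s Om (truncation Om u M).
Proof.
have mt := measurable_truncation; split => //.
case: Wu => _ [iu Wu2]; split.
  apply: le_integrable iu => //.
    by apply/measurable_EFinP; exact: measurable_funTS.
  by move=> x _; rewrite /= lee_fin normr_truncation_le.
(* The seminorm does not increase, by contraction; this comparison spares the measurability of the
   inner integrals in x. *)
apply: le_lt_trans Wu2; apply: ge0_le_integral_sup => x Ox.
  by apply: integral_ge0 => y _; rewrite lee_fin divr_ge0// powR_ge0.
apply: ge0_le_integral_sup => y Oy; first by rewrite lee_fin divr_ge0// powR_ge0.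
rewrite lee_fin ler_wpM2r ?invr_ge0 ?powR_ge0//.
exact: truncation_contraction.
Qed.

(** Finiteness allows dividing by this integral when gain and loss are compared. *)
Lemma excess_integral_lty : (\int[mu]_x (excess Om u M x)%:E < +oo)%E.
Proof.
case: Wu => _ [/integrableP[mEu iu] _].
have -> : (\int[mu]_x (excess Om u M x)%:E = \int[mu]_(x in Om) (excess Om u M x)%:E)%E.
  rewrite [RHS]integral_mkcond; apply: eq_integral => x _; rewrite patchE.
  by case: ifPn => // /negP xO; rewrite excess_out// => /mem_set.
apply: le_lt_trans iu; apply: ge0_le_integral_sup => x Ox.
  by rewrite lee_fin excess_ge0.
by rewrite /= lee_fin excess_le.
Qed.

End truncation_admissible.

(** * Gain against loss: the upper bound for a minimizer *)

Section one_sided_bound.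
Context {R : realType} {n : nat}.
Hypothesis n_ge1 : (1 <= n)%N.
Variables (s : R) (g : R -> R).
Hypothesis s_gt0 : 0 < s.
Hypotheses (g_range : forall t, 0 < g t <= 1)
  (g_even : forall t, g (- t) = g t) (g_cont : continuous g)
  (g_int : (\int[lebesgue_measure]_t (g t * `|t|)%:E < +oo)%E).
Local Notation T := (lebesgue_rV R n).
Local Notation mu := (@lebesgue_rV_measure R n).
Local Notation K := (primitive_bound g).
Local Notation q := (2 `^ (- s)).
Variables (Om : set 'rV[R]_n) (u : 'rV[R]_n -> R) (Theta N0 : R).
Hypotheses (oOm : open Om) (bOm : bounded_set Om) (Om0 : Om !=set0).
Hypotheses (Theta_ge2 : 2 <= Theta) (N0_ge0 : 0 <= N0).

Local Notation d := (diam Om).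
Local Notation N := (neighborhood Om (Theta * d) `\` Om).
Local Notation w := (excess Om u (d + N0)).
Local Notation v := (truncation Om u (d + N0)).
Local Notation a := (d / Num.sqrt n%:R).
Local Notation b := (2 * d / Num.sqrt n%:R).
Local Notation c := (primitive g (2^-1) * (2 * d) `^ (- (n%:R + s))).

Let d_gt0 : 0 < d. Proof. exact: diam_gt0. Qed.

Let M_ge0 : 0 <= d + N0. Proof. by rewrite addr_ge0// ltW. Qed.

Let w_ge0 x : 0 <= w x. Proof. exact: excess_ge0. Qed.

Let c_ge0 : 0 <= c.
Proof.
by rewrite mulr_ge0 ?powR_ge0// ltW// primitive_gt0// invr_gt0.
Qed.

Let box_annulus (x y : 'rV[R]_n) : box x a b y -> d < enorm (x - y) < 2 * d.
Proof.
move=> xy; rewrite enorm_distC; apply: enorm_annulus => // i.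
by have := xy i; rewrite !mxE.
Qed.

Lemma energy_gap_truncation (x y : 'rV[R]_n) : Om x -> (N y -> u y <= N0) ->
  (enorm (x - y) < Theta * d -> 0 <= energy_gap s g u v x y) /\
  (box x a b y -> c * w x <= energy_gap s g u v x y).
Proof.
move=> Ox Ny; have [Oy|Oy] := pselect (Om y).
  split=> [_|/box_annulus/andP[dxy _]].
    by apply: energy_gap_ge0 => //; exact: truncation_contraction.
  (* The cube misses [Om]: its points are farther from x than the diameter. *)
  by have := enorm_le_diam bOm Ox Oy; rewrite leNgt dxy.
have vy : v y = u y by exact: truncation_out.
have [w0|w0] := eqVneq (w x) 0.
  have H0 : 0 <= energy_gap s g u v x y.
    by apply: energy_gap_ge0 => //; rewrite vy /truncation w0 subr0.
  by split=> _ //; rewrite w0 mulr0.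
have [_ wE] := excess_neq0 w0.
have vx : v x = d + N0 by rewrite /truncation wE; ring.
have ux : d + N0 <= u x by have := w_ge0 x; rewrite wE subr_ge0.
have near_y : enorm (x - y) < Theta * d -> u y <= N0.
  move=> xy; apply: Ny; split => //; apply: contrapT.
  by move=> /(notin_neighborhood Ox); rewrite leNgt xy.
split=> [/near_y uy|xy].
  apply: energy_gap_ge0 => //; rewrite vy vx !ger0_norm; have := d_gt0; lra.
have /andP[lo hi] := box_annulus xy.
have uy : u y <= N0.
  (* Theta >= 2 puts the annulus within reach of the collar, where u is controlled. *)
  by apply: near_y; apply: lt_le_trans hi _; rewrite ler_wpM2r// ltW.
have -> : w x = (u x - u y) - (v x - v y) by rewrite wE vx vy; ring.
apply: energy_gap_lower => //; rewrite ?lo ?hi// vx vy; lra.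
Qed.

Hypothesis min_u : minimizer s g Om u.
Hypothesis ae_N0 : {ae mu, forall x, N x -> u x <= N0}.

Let mOm : measurable (Om : set T).
Proof. by apply: lebesgue_rV_measurable; exact: open_measurable_rV. Qed.

Let mw : measurable_fun [set: T] (w : T -> R).
Proof. exact: (measurable_excess (d + N0) oOm (proj1 min_u)). Qed.

Let mQ : measurable (Qset Om : set (T * T)).
Proof. by apply: measurableC; apply: measurableX; exact: measurableC. Qed.

Let H (z : T * T) : R := energy_gap s g u v z.1 z.2.

Let measurable_H : measurable_fun [set: T * T] H.
Proof.
have mr := @measurable_enormB R n.
have mE (f : T -> R) : measurable_fun setT f -> measurable_fun [set: T * T]
    (fun z => primitive (primitive g)
      ((f z.1 - f z.2) / enorm ((z.1 : 'rV[R]_n) - z.2))).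
  move=> mf; apply: measurableT_comp.
    by apply: continuous_measurable_fun; exact: primitive2_continuous.
  apply: measurable_fun_divr => //; last by move=> z; exact: enorm_ge0.
  by apply: measurable_funB; exact: measurableT_comp.
have mu_ : measurable_fun [set: T] (u : T -> R) by case: min_u => -[].
apply: measurable_fun_divr; last by move=> z; exact: powR_ge0.
  exact: (measurable_funB (mE _ mu_) (mE _ (measurable_funB mu_ mw))).
exact: (measurableT_comp (measurable_powR _) mr).
Qed.

Local Open Scope ereal_scope.

(** A bounds the gain from below and B the loss from above. A keeps only the pairs whose first point
    carries the excess. *)
Let A (z : T * T) : \bar R :=
  c%:E * (w z.1 * \1_[set z : T * T | box z.1 a b z.2] z)%:E.

Let B (z : T * T) : \bar R := K%:E * tail_kernel s w (Theta * d) z.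

Let Td_gt0 : (0 < Theta * d)%R.
Proof. by rewrite mulr_gt0// (lt_le_trans _ Theta_ge2). Qed.

Let K_ge0 : 0 <= K%:E.
Proof. by rewrite lee_fin ltW// primitive_bound_gt0. Qed.

Let A_ge0 z : 0 <= A z.
Proof. by rewrite mule_ge0// lee_fin mulr_ge0. Qed.

Let B_ge0 z : 0 <= B z.
Proof. by rewrite mule_ge0// tail_kernel_ge0. Qed.

Let measurable_A : measurable_fun [set: T * T] A.
Proof.
apply: measurable_funeM; apply/measurable_EFinP; apply: measurable_funM.
  exact: measurableT_comp.
by apply: measurable_indic; exact: measurable_box_pair.
Qed.

Let measurable_B : measurable_fun [set: T * T] B.
Proof. by apply: measurable_funeM; exact: measurable_tail_kernel. Qed.

Let ae_pair : {ae mu \x mu, forall z : T * T,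
  (N z.1 -> (u z.1 <= N0)%R) /\ (N z.2 -> (u z.2 <= N0)%R)}.
Proof.
have [E [mE E0 NE]] := ae_N0.
have null1 : (mu \x mu).-negligible (E `*` [set: T]).
  apply/negligibleP; first exact: measurableX.
  apply: etrans (product_measure1E _ _ _ _) _ => //.
  (* The other factor may be infinite; 0 * +oo = 0 here. *)
  exact: etrans (congr1 (fun t => t * mu setT) E0) (mul0e _).
have null2 : (mu \x mu).-negligible ([set: T] `*` E).
  apply/negligibleP; first exact: measurableX.
  apply: etrans (product_measure1E _ _ _ _) _ => //.
  exact: etrans (congr1 (fun t => mu setT * t) E0) (mule0 _).
apply: negligibleS (negligibleU null1 null2).
by move=> [x y] /= /not_andP[] h; [left|right]; split => //; exact: NE.
Qed.

Let A_le : {ae mu \x mu, forall z, Qset Om z -> A z <= (EFin \o H)^\+ z}.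
Proof.
apply: filterS ae_pair => -[x y] [_ /= hy] _.
rewrite funeposE /A/= indicE /H/=.
have [xy|xy] := pselect (box x a b y); last first.
  by rewrite memNset// mulr0 mule0 le_max lexx orbT.
rewrite mem_set// mulr1 -EFinM.
have [Ox|Ox] := pselect (Om x); last first.
  by rewrite excess_out// mulr0 le_max lexx orbT.
by rewrite le_max lee_fin (energy_gap_truncation Ox hy).2.
Qed.

Let B_ge : {ae mu \x mu, forall z, Qset Om z -> (EFin \o H)^\- z <= B z}.
Proof.
apply: filterS ae_pair => -[x y] [/= hx /= hy] Qxy.
rewrite funenegE /= ge_max B_ge0 andbT.
have [xy|xy] := ltP (enorm (x - y)) (Theta * d)%R.
  (* At distance less than Theta d the gap is nonnegative: a pair of [Qset] has a point in [Om],
     taken first by symmetry. *)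
  apply: le_trans (B_ge0 (x, y)); rewrite lee_fin oppr_le0 /H/=.
  have [Ox|Ox] := pselect (Om x); first exact: (energy_gap_truncation Ox hy).1.
  have [Oy|Oy] := pselect (Om y); last by case: Qxy.
  rewrite energy_gapC//; apply: (energy_gap_truncation Oy hx).1.
  by rewrite enorm_distC.
(* Far away, the increments of u and v differ by w x - w y, of absolute value at most w x + w y. *)
apply: (@le_trans _ _ (K * ((w x + w y) * enorm (x - y) `^ (- (n%:R + s))))%:E).
  rewrite lee_fin (le_trans (ler_norm _))// normrN /H/=.
  apply: le_trans (energy_gap_bound s g_range g_even g_cont g_int u v x y) _.
  rewrite ler_wpM2l -?lee_fin// lee_fin ler_wpM2r ?powR_ge0//.
  have -> : (u x - u y - (v x - v y) = w x - w y)%R by rewrite /truncation; ring.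
  by rewrite (le_trans (ler_normB _ _))// !ger0_norm.
rewrite EFinM lee_wpmul2l//.
exact: (le_tail_kernel s_gt0 w_ge0 Td_gt0 (z := (x, y))).
Qed.

Local Notation W := (\int[mu]_x (w x)%:E).

Let integral_A : \int[mu \x mu]_(z in Qset Om) A z =
  (c * (d / Num.sqrt n%:R) ^+ n)%:E * W.
Proof.
(* Outside [Qset] the first point is not in [Om], so the excess vanishes there. *)
have -> : \int[mu \x mu]_(z in Qset Om) A z = \int[mu \x mu]_z A z.
  rewrite integral_mkcond; apply: eq_integral => z _; rewrite patchE.
  case: ifPn => // /negP zQ; rewrite /A excess_out ?mul0r ?mule0// => Oz.
  by apply: zQ; rewrite inE => -[].
rewrite ge0_integralZl_EFin//; last 2 first.
- by move=> z _; rewrite lee_fin mulr_ge0.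
- apply/measurable_EFinP; apply: measurable_funM.
    exact: measurableT_comp.
  by apply: measurable_indic; exact: measurable_box_pair.
rewrite integral_box_pair1//.
  rewrite muleA -EFinM; congr ((_ * _ ^+ n)%:E * _)%E.
  by ring.
rewrite ler_wpM2r ?invr_ge0 ?sqrtr_ge0// mulr_natl mulr2n lerDl.
exact: ltW.
Qed.

Let integral_B : \int[mu \x mu]_(z in Qset Om) B z <=
  (K * (2 * 4 ^+ n * (Theta * d) `^ (- s) / (1 - q)))%:E * W.
Proof.
apply: (@le_trans _ _ (\int[mu \x mu]_z B z)).
  exact: ge0_subset_integral.
rewrite ge0_integralZl//; last 2 first.
- exact: measurable_tail_kernel.
- by move=> z _; exact: tail_kernel_ge0.
rewrite EFinM -muleA; apply: lee_wpmul2l => //.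
exact: integral_tail_kernel.
Qed.

(** Gain and loss coefficients both scale like d^(-s); the assumed strict inequality is what is left
    of their comparison, free of [Om]. *)
Lemma minimizer_le_of_gap :
  (K * (2 * 4 ^+ n * Theta `^ (- s) / (1 - q)) <
   primitive g (2^-1) * 2 `^ (- (n%:R + s)) * (Num.sqrt n%:R)^-1 ^+ n)%R ->
  {ae mu, forall x, Om x -> (u x <= d + N0)%R}.
Proof.
move=> gap.
have Wu : calW s Om u by case: min_u.
have W_ge0 : 0 <= W by apply: integral_ge0 => x _; rewrite lee_fin.
have W_fin : W \is a fin_num.
  by rewrite ge0_fin_numE//; exact: excess_integral_lty Wu.
have H_le0 : \int[mu \x mu]_(z in Qset Om) (H z)%:E <= 0.
  case: min_u => _ /(_ v); apply; first exact: calW_truncation.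
  by apply: aeW => x Ox; rewrite truncation_out.
have B_fin : \int[mu \x mu]_(z in Qset Om) B z < +oo.
  by apply: le_lt_trans integral_B _; rewrite -(fineK W_fin) -EFinM ltry.
have AB : \int[mu \x mu]_(z in Qset Om) A z <=
    \int[mu \x mu]_(z in Qset Om) B z.
  apply: (integral_le0_absorb (f := H)) => //; exact: measurable_funTS.
have W0 : W = 0.
  apply/eqP; rewrite eq_le W_ge0 andbT leNgt; apply/negP => W_gt0.
  have := le_trans AB integral_B; rewrite integral_A -(fineK W_fin) -!EFinM lee_fin.
  rewrite leNgt => /negP; apply.
  rewrite ltr_pM2r; last by rewrite fine_gt0// W_gt0 ltey_eq W_fin.
  have sd : (0 < d `^ (- s))%R by rewrite powR_gt0.
  have -> : (K * (2 * 4 ^+ n * (Theta * d) `^ (- s) / (1 - q)) =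
      K * (2 * 4 ^+ n * Theta `^ (- s) / (1 - q)) * d `^ (- s))%R.
    by rewrite powRM ?(ltW d_gt0) ?(le_trans _ Theta_ge2)//; ring.
  (* The volume factor d^n cancels against d^(-n-s), leaving d^(-s). *)
  have -> : (c * (d / Num.sqrt n%:R) ^+ n =
      primitive g 2^-1 * 2 `^ (- (n%:R + s)) * (Num.sqrt n%:R)^-1 ^+ n * d `^ (- s))%R.
    rewrite powRM ?(ltW d_gt0)// exprMn.
    have -> : (d `^ (- (n%:R + s)) = (d ^+ n)^-1 * d `^ (- s))%R.
      rewrite opprD powRD; last by apply/implyP => _; rewrite gt_eqF.
      by congr (_ * _)%R; rewrite powRN powR_mulrn// ltW.
    have : (d ^+ n != 0)%R by rewrite expf_eq0 gt_eqF// andbF.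
    move: (d ^+ n)%R (d `^ (- s))%R (2 `^ _)%R (_^-1 ^+ n)%R => e1 e2 e3 e4 e10.
    by field.
  by rewrite ltr_pM2r.
have mEw : measurable_fun [set: T] (EFin \o w) by exact/measurable_EFinP.
have w_int0 : \int[mu]_x `|(EFin \o w) x| = 0.
  by rewrite -[RHS]W0; apply: eq_integral => x _; rewrite gee0_abs ?lee_fin.
(* A nonnegative function with zero integral vanishes almost everywhere. *)
have := (ae_eq_integral_abs _ measurableT mEw).1 w_int0.
apply: filterS => x /= /(_ I) [wx] Ox.
by move: wx; rewrite excess_in// => /eqP; rewrite eq_maxr subr_le0.
Qed.

End one_sided_bound.

#[local] Instance lebesgue_rV_ae_filter (R : realType) (n : nat) :
  Filter (nbhs (almost_everywhere (@lebesgue_rV_measure R n))).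
Proof. exact: ae_filter_ringOfSetsType. Qed.

(** * Negation of minimizers, essential bounds, choice of scale *)

Section symmetry_and_sup_norm.
Context {R : realType} {n : nat}.
Local Notation T := (lebesgue_rV R n).
Local Notation mu := (@lebesgue_rV_measure R n).
Implicit Types (Om A : set 'rV[R]_n) (u : 'rV[R]_n -> R).

Lemma calW_opp s Om u : calW s Om u -> calW s Om (\- u).
Proof.
move=> [m_u [i_u u_fin]]; split; first exact: measurableT_comp.
split; first by have := integrableN i_u.
apply: le_lt_trans u_fin; rewrite le_eqVlt; apply/orP; left; apply/eqP.
apply: eq_integral => x _; apply: eq_integral => y _.
by rewrite /= -opprD normrN.
Qed.

(** A competitor v for - u corresponds to the competitor - v for u, with the same integrand because
    GG is even. *)
Lemma minimizer_opp s (g : R -> R) Om u : (forall t, 0 < g t <= 1) ->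
  (forall t, g (- t) = g t) -> continuous g ->
  minimizer s g Om u -> minimizer s g Om (\- u).
Proof.
move=> g_range g_even g_cont [Wu min_u]; split; first exact: calW_opp.
move=> v Wv vu; have := min_u _ (calW_opp Wv).
have vu' : {ae mu, forall x, (~` Om) x -> (\- v) x = u x}.
  by apply: filterS vu => x vx Ox; rewrite /= vx//= opprK.
move=> /(_ vu'); apply: le_trans; rewrite le_eqVlt; apply/orP; left; apply/eqP.
have E (f : 'rV[R]_n -> R) (x y : 'rV[R]_n) (r : R) :
    primitive (primitive g) ((- f x - - f y) / r) =
    primitive (primitive g) ((f x - f y) / r).
  rewrite -[LHS]primitive2_abs// -[RHS]primitive2_abs//.
  by rewrite -opprD mulNr normrN.
by apply: eq_integral => z _; rewrite /= !E.
Qed.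

Lemma Linfty_norm_ge0 A u : (0 <= Linfty_norm A u)%E.
Proof. exact: Lnorm_ge0. Qed.

Lemma Linfty_norm_ae A u : (Linfty_norm A u < +oo)%E ->
  {ae mu, forall x, A x -> `|u x| <= fine (Linfty_norm A u)}.
Proof.
move=> Afin.
have Linf_fin : (Linfty_norm A u \is a fin_num)%E.
  by rewrite ge0_fin_numE// Linfty_norm_ge0.
have [mu0|mu0] := ltP (0 : \bar R)%E (mu [set: T]); last first.
  (* For a space of measure zero the norm is 0 by convention, but then every property holds almost
     everywhere. *)
  exists [set: T]; split => //; apply/eqP; rewrite -measure_le0//.
have : {ae mu, forall x, (abse \o ((EFin \o u) \_ A)) x <= Linfty_norm A u}%E.
  rewrite /Linfty_norm unlock mu0; exact: ess_sup_ge.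
apply: filterS => x /= ux Ax; rewrite -lee_fin fineK//.
by move: ux; rewrite patchE mem_set.
Qed.

Lemma Linfty_norm_le A u (c : R) : 0 <= c ->
  {ae mu, forall x, A x -> `|u x| <= c} -> (Linfty_norm A u <= c%:E)%E.
Proof.
move=> c0 uc; rewrite /Linfty_norm unlock; case: ifP => _; last by rewrite lee_fin.
apply/ess_supP; apply: filterS uc => x /= ux; rewrite patchE.
case: ifPn => [/set_mem/ux|_]; first by rewrite /= lee_fin.
by rewrite abse0 lee_fin.
Qed.

Lemma diam_ge0 Om : bounded_set Om -> 0 <= diam Om.
Proof.
move=> bO; have [->|/set0P[x Ox]] := eqVneq Om set0.
  by rewrite /diam set0X image_set0 sup0.
by apply: le_trans (enorm_ge0 _) (enorm_le_diam bO Ox Ox).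
Qed.

Lemma exists_scale (s al be : R) : 0 < s -> 0 < al -> 0 < be ->
  exists2 Theta, 2 <= Theta & be * Theta `^ (- s) < al.
Proof.
move=> s0 al0 be0; pose t := be / al + 1.
have t0 : 0 < t by rewrite addr_gt0// divr_gt0.
(* Theta^s >= t > be / al, which is the required inequality. *)
exists (Num.max 2 (t `^ s^-1)); first by rewrite le_max lexx.
set Theta := Num.max _ _.
have Theta0 : 0 < Theta by rewrite lt_max ltr0n.
rewrite powRN ltr_pdivrMr ?powR_gt0//.
have tT : t <= Theta `^ s.
  rewrite -[leLHS](powRr1 (ltW t0)) -[X in _ `^ X](@mulVf _ s) ?gt_eqF//.
  rewrite powRrM; apply: ge0_ler_powR;
    rewrite ?nnegrE ?powR_ge0 ?(ltW s0) ?(ltW Theta0)//.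
  by rewrite le_max lexx orbT.
apply: lt_le_trans (ler_wpM2l (ltW al0) tT).
by rewrite /t mulrDr mulr1 mulrCA mulfV ?gt_eqF// mulr1 ltrDl.
Qed.

End symmetry_and_sup_norm.

(** * Choice of Theta and the two-sided bound *)

Theorem theorem1p4 (R : realType) (n : nat) (n_ge1 : (1 <= n)%N)
    (s : R) (s_gt0 : 0 < s) (s_lt1 : s < 1)
    (g : R -> R) (g_range : forall t, 0 < g t <= 1)
    (g_even : forall t, g (- t) = g t) (g_cont : continuous g)
    (g_int : (\int[lebesgue_measure]_t (g t * `|t|)%:E < +oo)%E) :
  exists Theta : R, 0 < Theta /\
    forall Om : set 'rV[R]_n,
      open Om -> bounded_set Om -> lipschitz_boundary Om ->
    forall u : 'rV[R]_n -> R,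
      minimizer s g Om u ->
      let N := neighborhood Om (Theta * diam Om) `\` Om in
      (Linfty_norm N u < +oo)%E ->
      (Linfty_norm Om u < +oo)%E /\
      (Linfty_norm Om u <= (diam Om)%:E + Linfty_norm N u)%E.
Proof.
have K0 := primitive_bound_gt0 g_range.
have G0 : 0 < primitive g 2^-1 by apply: primitive_gt0 => //; rewrite invr_gt0.
have q1 : 0 < 1 - 2 `^ (- s) by rewrite subr_gt0 powR2N_lt1.
(* [Th] is fixed before [Om] and u appear, so it depends on n, s and g only. *)
have [Th Th2 gap] : exists2 Th, 2 <= Th &
    primitive_bound g * (2 * 4 ^+ n * Th `^ (- s) / (1 - 2 `^ (- s))) <
    primitive g 2^-1 * 2 `^ (- (n%:R + s)) * (Num.sqrt n%:R)^-1 ^+ n.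
  have al0 : 0 < primitive g 2^-1 * 2 `^ (- (n%:R + s)) * (Num.sqrt n%:R)^-1 ^+ n.
    by rewrite !mulr_gt0 ?powR_gt0 ?exprn_gt0 ?invr_gt0 ?sqrtr_gt0 ?ltr0n.
  have be0 : 0 < primitive_bound g * (2 * 4 ^+ n / (1 - 2 `^ (- s))).
    by rewrite !mulr_gt0 ?exprn_gt0 ?invr_gt0.
  have [Th Th2 gap] := exists_scale s_gt0 al0 be0; exists Th => //.
  by apply: le_lt_trans gap; rewrite le_eqVlt; apply/orP; left; apply/eqP; ring.
exists Th; split; first exact: lt_le_trans Th2.
move=> Om oOm bOm _ u min_u N N_fin.
set N0 := fine (Linfty_norm N u).
have N0_ge0 : 0 <= N0 by rewrite fine_ge0// Linfty_norm_ge0.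
have -> : Linfty_norm N u = N0%:E.
  by rewrite fineK// ge0_fin_numE// Linfty_norm_ge0.
have aeN := Linfty_norm_ae N_fin.
rewrite -EFinD; suff bound : (Linfty_norm Om u <= (diam Om + N0)%:E)%E.
  by split => //; exact: le_lt_trans bound (ltry _).
apply: Linfty_norm_le; first by rewrite addr_ge0// diam_ge0.
(* The empty set is set apart because the comparison needs a positive diameter. *)
have [Om0|/set0P Om0] := eqVneq Om set0.
  by apply: aeW => x; rewrite Om0.
have one_sided (f : 'rV[R]_n -> R) : minimizer s g Om f ->
    {ae lebesgue_rV_measure (R := R) (n := n), forall x, N x -> f x <= N0} ->
    {ae lebesgue_rV_measure (R := R) (n := n),
      forall x, Om x -> f x <= diam Om + N0}.
  move=> min_f aef.
  exact: (minimizer_le_of_gap n_ge1 s_gt0 g_range g_even g_cont g_int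
    oOm bOm Om0 Th2 N0_ge0 min_f aef gap).
have u_le : {ae lebesgue_rV_measure (R := R) (n := n),
    forall x, Om x -> u x <= diam Om + N0}.
  apply: one_sided => //; apply: filterS aeN => x ux /ux.
  exact: le_trans (ler_norm _).
have Nu_le : {ae lebesgue_rV_measure (R := R) (n := n),
    forall x, Om x -> (\- u) x <= diam Om + N0}.
  apply: one_sided; first exact: minimizer_opp.
  apply: filterS aeN => x ux /ux; apply: le_trans.
  by rewrite /= -normrN; exact: ler_norm.
apply: filterS2 u_le Nu_le => x h1 h2 Ox.
by rewrite ler_norml h1// andbT lerNl; exact: h2.
Qed.
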